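(* The defining identities of the variety $\mathrm{DerPerm}_{\succ}$ are $$x_1\succ(x_2\succ x_3)=x_2\succ(x_1\succ x_3),$$ $$\langle x_1,x_2\succ x_3,x_4\rangle-\langle x_1,x_3,x_2\succ x_4\rangle=0,$$ $$\langle x_1,x_2,x_3\rangle\succ x_4-\langle x_1,x_3,x_2\rangle\succ x_4=0,$$ where $\langle a,b,c\rangle=(a\succ b)\succ c-a\succ(b\succ c)$. That is, an algebra with one bilinear operation $\succ$ belongs to $\mathrm{DerPerm}_{\succ}$ if and only if it satisfies these three identities.
   Context: All algebras are over a fixed field $\mathbb K$. A perm algebra is an associative (not necessarily unital) algebra satisfying $abc=bac$. $\mathrm{DerPerm}_{\succ}$ denotes the class of all algebras $(B,\succ)$ with one bilinear operation that embed (via an injective algebra homomorphism) into $(A,\succ)$ for some perm algebra $A$ with a derivation $d$, where $a\succ b=d(a)b$ on $A$; this class is a variety. Its free algebra on a set $X$ is the subalgebra generated by $X$, under $a\succ b=d(a)b$, of the free perm algebra with derivation $d$ generated by $X$. *)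

(* Defs.v *)
From mathcomp Require Import all_boot all_algebra.

Set Implicit Arguments.
Unset Strict Implicit.
Unset Printing Implicit Defensive.

Import GRing.Theory.
Local Open Scope ring_scope.

(* An algebra over the field K is an arbitrary K-vector space V with an
   explicit bilinear product V -> V -> V: MathComp's algType would force the
   product to be unital and associative. *)

Definition is_perm (K : fieldType) (A : lmodType K)
    (mul : {bilinear A -> A -> A}) : Prop :=
  (forall a b c : A, mul (mul a b) c = mul a (mul b c)) /\
  (forall a b c : A, mul (mul a b) c = mul (mul b a) c).

Definition is_derivation (K : fieldType) (A : lmodType K)
    (mul : {bilinear A -> A -> A}) (d : {linear A -> A}) : Prop :=
  forall a b : A, d (mul a b) = mul (d a) b + mul a (d b).

Definition der_succ (K : fieldType) (A : lmodType K)
    (mul : {bilinear A -> A -> A}) (d : {linear A -> A}) (a b : A) : A :=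
  mul (d a) b.

Definition in_DerPerm_succ (K : fieldType) (B : lmodType K)
    (op : {bilinear B -> B -> B}) : Prop :=
  exists (A : lmodType K) (mul : {bilinear A -> A -> A})
         (d : {linear A -> A}) (phi : {linear B -> A}),
    [/\ is_perm mul,
        is_derivation mul d,
        injective phi
      & forall x y : B, phi (op x y) = der_succ mul d (phi x) (phi y)].

Definition associator (K : fieldType) (B : lmodType K)
    (op : {bilinear B -> B -> B}) (a b c : B) : B :=
  op (op a b) c - op a (op b c).

(* Main.v *)
From HB Require Import structures.
From mathcomp Require Import all_boot all_algebra.
From mathcomp Require Import boolp functions.
Require Import Defs.

Set Implicit Arguments.
Unset Strict Implicit.
Unset Printing Implicit Defensive.

Import GRing.Theory.
Local Open Scope ring_scope.

(** Write [a > b] for the operation and [a'] for the derivative of [a].  In a perm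
algebra the factors of a product that precede the last one can be permuted, and
[<a, b, c> = (a' b)' c - a' b' c = a'' b c].  The three identities then express
this freedom in [a' b' c], in [a'' b' c x] and in [(a'' b c)' x].

For the converse, let [B] satisfy the identities.  It suffices to find a vector
space [V] with a linear endomorphism [d], a linear family of operators [nu b]
on [V] that generate a commutative algebra under composition and the derivation
[ad d = [d, -]], and a linear injection [psi : B -> V] with
[nu (a > b) = [d, nu a] nu b] and [psi (a > b) = [d, nu a] (psi b)].  Indeed, if
[R] is the bicommutant of these operators, then [R * V] with product
[(X, v) (Y, w) = (X Y, X w)] is a perm algebra, [(X, v) |-> ([d, X], d v)] is a
derivation, and [b |-> (nu b, psi b)] embeds [B]
([in_DerPerm_succ_of_representation]).

To find [V], give [b^(k)] the weight [k - 1].  In a commutative differential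
algebra [C] generated by the image of [B], an element of weight 0 should act on
[B], with [a'] acting as the left multiplication [L_a]; an element of weight
[m > 0] is known through its products with [m] elements of [B], that is, as a
[m]-linear symmetric function on [B] with values in weight 0.  Weight 0 is
modelled by the operators in [coefficient], contained in the bicommutant of the
left multiplications, and weight [m] by the functions in [tensor].
The rule [c u' = (u c)' - u c'] dictates that [c u'] must be the operator
[der_along c u = L_(u c) - u L_c], and hence how to differentiate tensors.
All that has to be checked is that the symmetry conditions survive
multiplication ([tensor_conv]) and differentiation ([tensor_der]), and that the
derivation is a derivation ([der_conv]); the second identity makes [der_along]
linear over weight 0 and a derivation ([der_along_equivariant]), the third one makes
[(a'' b) c] symmetric in [b] and [c] up to elements with zero left
multiplication ([coefficient_op]).

The algebra [C] itself is spanned by products [c_1 ... c_k f] of elements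
[c_i] of [B] with a tensor [f], subject to [c f = f(c, -)] when [f] has positive
weight.  The space [V] consists of the linear functionals on [C] with values in
[B], encoded as functions of the list [c_1, ..., c_k] and of [f]; the algebra
[C] acts on them by composition with multiplication, and [d] by [- (_ \o d)].
The vector [psi x] is the functional [f |-> f x] in weight 0; evaluation at the
unit shows that [psi] is injective.  Functionals with values in [B] are needed
because [C] itself only contains a quotient of [B], by elements with zero left
multiplication. *)

(** * The identities hold in differential perm algebras *)

Section Necessity.
Variables (K : fieldType) (A : lmodType K) (mul : {bilinear A -> A -> A})
  (d : {linear A -> A}).
Hypothesis mul_perm : is_perm mul.
Hypothesis d_der : is_derivation mul d.

Lemma der_succ_left_comm a b c :
  der_succ mul d a (der_succ mul d b c) = der_succ mul d b (der_succ mul d a c).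
Proof. by have [mulA mulC] := mul_perm; rewrite /der_succ -!mulA mulC. Qed.

Lemma der_succ_associator a b c :
  der_succ mul d (der_succ mul d a b) c - der_succ mul d a (der_succ mul d b c) =
  mul (mul (d (d a)) b) c.
Proof.
have [mulA _] := mul_perm.
by rewrite /der_succ d_der linearDl /= -mulA addrK.
Qed.

Lemma der_succ_assoc_shift a b c x :
  mul (mul (d (d a)) (der_succ mul d b c)) x = mul (mul (d (d a)) c) (der_succ mul d b x).
Proof.
have [mulA mulC] := mul_perm.
rewrite /der_succ !mulA; congr (mul _ _).
by rewrite -!mulA mulC.
Qed.

(** Two factors that both precede the last one may be exchanged.  In
[(a'' b c)' x] the letters [b] and [c] always precede [x], differentiated or
not, although in [a'' b c] alone they cannot be exchanged. *)
Lemma der_succ_assoc_sym a b c x :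
  der_succ mul d (mul (mul (d (d a)) b) c) x = der_succ mul d (mul (mul (d (d a)) c) b) x.
Proof.
have [mulA mulC] := mul_perm.
have sw u v w y : mul (mul (mul u v) w) y = mul (mul (mul u w) v) y.
  by rewrite !mulA -[mul v (mul w y)]mulA mulC mulA.
rewrite /der_succ !d_der !linearDl /=.
rewrite (sw _ b c) (sw _ (d b) c) (sw _ b (d c)).
by rewrite -!addrA; congr (_ + _); rewrite addrC.
Qed.
End Necessity.

(** * Subspaces and commutants *)

Definition lin_closed (K : fieldType) (W : lmodType K) (P : W -> Prop) : Prop :=
  P 0 /\ forall (a : K) (u v : W), P u -> P v -> P (a *: u + v).

Section Subspace.
Variables (K : fieldType) (W : lmodType K) (P : W -> Prop) (clP : lin_closed P).

(** The closure proof is a parameter so that the vector space structure can be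
inferred from the type alone. *)
Record subspace (cl : lin_closed P) := Subspace {sub_val : W; _ : `[< P sub_val >]}.

HB.instance Definition _ := [isSub of subspace clP for @sub_val clP].
HB.instance Definition _ := [Choice of subspace clP by <:].

Fact subspace_submod_closed :
  GRing.subsemimod_closed [pred w : W | `[< P w >]].
Proof.
have [P0 Plin] := clP.
split; first (split; first exact/asboolP).
  move=> u v /asboolP Pu /asboolP Pv; apply/asboolP.
  by rewrite -[u]scale1r; exact: Plin.
by move=> a u /asboolP Pu; apply/asboolP; rewrite -[_ *: _]addr0; exact: Plin.
Qed.

HB.instance Definition _ :=
  GRing.SubChoice_isSubLmodule.Build K W _ (subspace clP) subspace_submod_closed.

Definition insubspace (w : W) (Pw : P w) : subspace clP := Subspace clP (asboolT Pw).

Lemma subspaceP (u : subspace clP) : P (val u).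
Proof. by case: u => w /= /asboolP. Qed.

Lemma subspace_lin (a : K) (u v : subspace clP) : val (a *: u + v) = a *: val u + val v.
Proof. exact: (linearP (val : subspace clP -> W)). Qed.
End Subspace.

Lemma linfctE (K : fieldType) (T : Type) (V : lmodType K) (a : K) (f g : T -> V) (x : T) :
  (a *: f + g) x = a *: f x + g x.
Proof. by []. Qed.

Section LinearFacts.
Variables (K : fieldType) (U V : lmodType K) (f : U -> V).
Hypothesis flin : linear f.

Lemma linear_sub u v : f (u - v) = f u - f v.
Proof. exact: (zmod_morphism_linear flin). Qed.

Lemma linear_zero : f 0 = 0.
Proof. by rewrite -(subrr 0) linear_sub subrr. Qed.

Lemma linear_add u v : f (u + v) = f u + f v.
Proof. by rewrite -[u in LHS]scale1r flin scale1r. Qed.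

End LinearFacts.

Lemma lin_closed_sub (K : fieldType) (W : lmodType K) (P : W -> Prop) u v :
  lin_closed P -> P u -> P v -> P (u - v).
Proof. by move=> [_ Plin] Pu Pv; rewrite addrC -scaleN1r; exact: Plin. Qed.

Lemma lin_closed_add (K : fieldType) (W : lmodType K) (P : W -> Prop) u v :
  lin_closed P -> P u -> P v -> P (u + v).
Proof. by move=> [_ Plin] Pu Pv; rewrite -[u]scale1r; exact: Plin. Qed.

(** The commutant among linear maps, not among all functions: a bicommutant
then consists of maps that commute with every linear map equivariant under
[S], which is how linearity over an algebra will be transferred from
generators to all scalars. *)
Definition commutant (K : fieldType) (W : lmodType K) (S : (W -> W) -> Prop)
    (Y : W -> W) : Prop :=
  linear Y /\ forall X, S X -> forall w, Y (X w) = X (Y w).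

Notation bicommutant S := (commutant (commutant S)).

Section Commutant.
Variables (K : fieldType) (W : lmodType K) (S : (W -> W) -> Prop).

Lemma commutant_lin : (forall X, S X -> linear X) -> lin_closed (commutant S).
Proof.
move=> S_linear; split=> [|a Y Z [Ylin YS] [Zlin ZS]].
  by split=> [c x y|X XS w] /=; rewrite ?scaler0 ?addr0 // (linear_zero (S_linear X XS)).
split=> [c x y|X XS w]; rewrite !linfctE.
  by rewrite Ylin Zlin !scalerDr !scalerA addrACA [a * c]mulrC.
by rewrite YS // ZS // (S_linear X XS).
Qed.

Lemma commutant_id : commutant S id.
Proof. by []. Qed.

Lemma commutant_comp Y Z : commutant S Y -> commutant S Z -> commutant S (Y \o Z).
Proof.
move=> [Ylin YS] [Zlin ZS]; split=> [c x y|X XS w] /=.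
  by rewrite Zlin Ylin.
by rewrite ZS // YS.
Qed.
End Commutant.

Section Bicommutant.
Variables (K : fieldType) (W : lmodType K) (S : (W -> W) -> Prop).
Hypothesis S_linear : forall X, S X -> linear X.
Hypothesis S_comm : forall X Y, S X -> S Y -> forall w, X (Y w) = Y (X w).

Lemma commutant_sub X : S X -> commutant S X.
Proof. by move=> XS; split=> [|Y YS w]; [exact: (S_linear XS) | exact: (S_comm XS YS)]. Qed.

Lemma bicommutant_sub X : S X -> bicommutant S X.
Proof. by move=> XS; split=> [|Y [_ YS] w]; [exact: (S_linear XS) | rewrite YS]. Qed.

Lemma bicommutantW X : bicommutant S X -> commutant S X.
Proof. by move=> [Xlin XS]; split=> // Y YS w; apply: XS; exact: commutant_sub. Qed.

(** The bicommutant of a commuting family is contained in the commutant, hence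
is commutative. *)
Lemma bicommutant_comm X Y w :
  bicommutant S X -> bicommutant S Y -> X (Y w) = Y (X w).
Proof. by move=> [_ XS] /bicommutantW /XS. Qed.

Lemma bicommutant_lin : lin_closed (bicommutant S).
Proof. by apply: commutant_lin => X []. Qed.

End Bicommutant.

Section Adjoint.
Variables (K : fieldType) (W : lmodType K) (d : W -> W).
Hypothesis d_lin : linear d.

(** The inner derivation [[d, -]] of the algebra of endomorphisms. *)
Definition ad (X : W -> W) : W -> W := fun w => d (X w) - X (d w).

Lemma ad_linear X : linear X -> linear (ad X).
Proof.
move=> Xlin c x y; rewrite /ad Xlin !d_lin Xlin scalerBr opprD.
by rewrite addrACA.
Qed.

(** Apply the derivation [ad] to [X Y = Y X]: since [ad X] still commutes with
[Y], so does [X] with [ad Y]. *)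
Lemma commutant_ad (S : (W -> W) -> Prop) :
  (forall X, S X -> linear X) -> (forall X, S X -> S (ad X)) ->
  forall Y, commutant S Y -> commutant S (ad Y).
Proof.
move=> S_linear S_ad Y [Ylin YS]; split=> [|X XS w]; first exact: ad_linear.
have /eqP := YS _ (S_ad _ XS) w.
rewrite /ad (linear_sub Ylin) (linear_sub (S_linear _ XS)) !(YS _ XS).
by rewrite subr_eq => /eqP ->; rewrite opprD opprB addrA [d _ + (_ - _)]addrC subrK.
Qed.

Lemma bicommutant_ad (S : (W -> W) -> Prop) :
  (forall X, S X -> linear X) -> (forall X, S X -> S (ad X)) ->
  forall X, bicommutant S X -> bicommutant S (ad X).
Proof.
move=> S_linear S_ad X; apply: commutant_ad => [Y []//|Y].
exact: commutant_ad.
Qed.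

End Adjoint.

(** * From representations to perm algebras with derivation *)

Section Representation.
Variables (K : fieldType) (V : lmodType K) (S : (V -> V) -> Prop) (d : V -> V).
Hypothesis S_linear : forall X, S X -> linear X.
Hypothesis S_comm : forall X Y, S X -> S Y -> forall w, X (Y w) = Y (X w).
Hypothesis d_lin : linear d.
Hypothesis S_ad : forall X, S X -> S (ad d X).

(** The perm algebra is the sum of the commutative algebra [bicommutant S] and
of its module [V], with product [(X, v) (Y, w) = (X Y, X w)]: only the first
component of the left factor matters, and those components commute. *)
Let is_scalar_part (p : (V -> V) * V) : Prop := bicommutant S p.1.

Fact is_scalar_part_lin : lin_closed is_scalar_part.
Proof.
have [b0 blin] := bicommutant_lin S.
by split=> // a u v; exact: blin.
Qed.

Definition perm_ext := subspace is_scalar_part_lin.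

Definition perm_ext_mul (x y : perm_ext) : perm_ext :=
  insubspace is_scalar_part_lin
    (w := ((val x).1 \o (val y).1, (val x).1 (val y).2))
    (commutant_comp (subspaceP x) (subspaceP y)).

Definition perm_ext_der (x : perm_ext) : perm_ext :=
  insubspace is_scalar_part_lin (w := (ad d (val x).1, d (val x).2))
    (bicommutant_ad d_lin S_linear S_ad (subspaceP x)).

Fact perm_ext_mul_bilinear :
  bilinear_for *:%R *:%R perm_ext_mul.
Proof.
split=> z a x y; apply: val_inj.
  by rewrite subspace_lin; congr pair.
have [zlin _] := subspaceP z.
rewrite subspace_lin; congr pair; last by rewrite /= zlin.
by apply/funext => w; rewrite /= zlin.
Qed.

HB.instance Definition _ :=
  bilinear_isBilinear.Build K perm_ext perm_ext perm_ext *:%R *:%R perm_ext_mul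
    perm_ext_mul_bilinear.

Fact perm_ext_der_linear : linear perm_ext_der.
Proof.
move=> a x y; apply: val_inj; rewrite subspace_lin; congr pair; last exact: d_lin.
apply/funext => w; rewrite linfctE /= /ad linfctE d_lin.
by rewrite scalerBr opprD addrACA.
Qed.

HB.instance Definition _ :=
  GRing.isLinear.Build K perm_ext perm_ext *:%R perm_ext_der perm_ext_der_linear.

Variables (B : lmodType K) (op : {bilinear B -> B -> B}).
Variables (nu : B -> V -> V) (psi : B -> V).
Hypothesis nu_S : forall b, S (nu b).
Hypothesis nu_lin : linear nu.
Hypothesis nu_op : forall a b v, nu (op a b) v = ad d (nu a) (nu b v).
Hypothesis psi_lin : linear psi.
Hypothesis psi_inj : injective psi.
Hypothesis psi_op : forall a b, psi (op a b) = ad d (nu a) (psi b).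

Definition perm_ext_emb (b : B) : perm_ext :=
  insubspace is_scalar_part_lin (w := (nu b, psi b)) (bicommutant_sub S_linear (nu_S b)).

Fact perm_ext_emb_linear : linear perm_ext_emb.
Proof.
move=> a x y; apply: val_inj; rewrite subspace_lin /=; congr pair.
  exact: nu_lin.
exact: psi_lin.
Qed.

HB.instance Definition _ :=
  GRing.isLinear.Build K B perm_ext *:%R perm_ext_emb perm_ext_emb_linear.

(** The equations for [nu] and [psi] are the two components of
[phi (a > b) = d (phi a) phi b] for [phi b = (nu b, psi b)]; injectivity comes
from the second component. *)
Lemma in_DerPerm_succ_of_representation : in_DerPerm_succ op.
Proof.
exists perm_ext, perm_ext_mul, perm_ext_der, perm_ext_emb; split.
- split=> x y z; first by apply: val_inj.
  have xy w := bicommutant_comm S_linear S_comm w (subspaceP x) (subspaceP y).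
  by apply: val_inj; congr pair; [apply/funext => w|]; rewrite /= xy.
- move=> x y; apply: val_inj; rewrite -[X in _ = X]/(_ + _).
  have [xlin _] := subspaceP x.
  congr pair; [apply/funext => w|].
    by rewrite /= /ad addrfctE /= (linear_sub xlin) addrA subrK.
  by rewrite /= /ad /= subrK.
- by move=> x y /(congr1 (fun p => (val p).2)) /psi_inj.
move=> x y; apply: val_inj; congr pair; last exact: psi_op.
by apply/funext => w; exact: nu_op.
Qed.

End Representation.

(** * Scalars and directional derivatives on the algebra *)

Section Embedding.
Variables (K : fieldType) (B : lmodType K) (op : {bilinear B -> B -> B}).

Definition left_mult (X : B -> B) : Prop := exists a, X = op a.

Lemma op_linl x : linear (op ^~ x).
Proof. by move=> c a b; exact: linearPl. Qed.

Lemma op_linr a : linear (op a).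
Proof. by move=> c x y; exact: linearPr. Qed.

Lemma left_mult_linear X : left_mult X -> linear X.
Proof. by move=> [a ->]; exact: op_linr. Qed.

(** The scalars play the part of weight 0: [op a] stands for multiplication by
[a'].  Any linear map that commutes with all [op a] is linear over them. *)
Notation scalar := (bicommutant left_mult).

(** The operator [c u'], from [(u c)' = u' c + u c'] and [a' = op a]. *)
Definition der_along (c : B) (u : B -> B) : B -> B :=
  fun x => op (u c) x - u (op c x).

(** The largest subspace stable under scalars on which the left multiplication
vanishes.  Its elements are invisible in every factor but the last one, so
that all factors but the last may be taken modulo [left_null]. *)
Definition left_null (z : B) : Prop := forall u, scalar u -> forall x, op (u z) x = 0.

(** In a commutative algebra [(a u') b = (b u') a]; the condition asks for this
in the quotient by [left_null]. *)
Definition coefficient (u : B -> B) : Prop :=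
  scalar u /\ forall a b, left_null (der_along a u b - der_along b u a).

Lemma scalar_linear u : scalar u -> linear u.
Proof. by case. Qed.

Lemma left_null_lin : lin_closed left_null.
Proof.
split=> [u us x|a y z yk zk u us x].
  by rewrite (linear_zero (scalar_linear us)) linear0l.
by rewrite (scalar_linear us) op_linl yk // zk // scaler0 addr0.
Qed.

Lemma left_null_scalar u z : scalar u -> left_null z -> left_null (u z).
Proof. by move=> us zk v vs x; exact: (zk _ (commutant_comp vs us)). Qed.

Lemma left_null_op z x : left_null z -> op z x = 0.
Proof. by move=> /(_ _ (commutant_id _)). Qed.

Lemma der_along_lin u : linear u -> forall x, linear (fun c => der_along c u x).
Proof.
move=> ulin x a y z; rewrite /der_along ulin !op_linl ulin scalerBr opprD.
by rewrite addrACA.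
Qed.

Lemma der_along_linr c x a u v :
  der_along c (a *: u + v) x = a *: der_along c u x + der_along c v x.
Proof.
by rewrite /der_along !linfctE op_linl scalerBr opprD addrACA.
Qed.

Hypothesis op_left_comm : forall a b c, op a (op b c) = op b (op a c).
Hypothesis assoc_shift :
  forall a b c x, associator op a (op b c) x = associator op a c (op b x).
Hypothesis assoc_sym :
  forall a b c x, op (associator op a b c) x = op (associator op a c b) x.

Lemma left_mult_comm X Y : left_mult X -> left_mult Y -> forall w, X (Y w) = Y (X w).
Proof. by move=> [a ->] [b ->] w; exact: op_left_comm. Qed.

Lemma scalar_op a : scalar (op a).
Proof. by apply: (bicommutant_sub left_mult_linear); exists a. Qed.

Lemma scalar_comm u v x : scalar u -> scalar v -> u (v x) = v (u x).
Proof. exact: (bicommutant_comm left_mult_linear left_mult_comm). Qed.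

Lemma scalar_equivariant u : scalar u -> commutant left_mult u.
Proof. exact: (bicommutantW left_mult_linear left_mult_comm). Qed.

Lemma equivariantP Y : linear Y -> (forall a x, Y (op a x) = op a (Y x)) ->
  commutant left_mult Y.
Proof. by move=> Ylin YL; split=> // X [a ->]; exact: YL. Qed.

Lemma equivariant_scalar Y u x : commutant left_mult Y -> scalar u -> Y (u x) = u (Y x).
Proof. by move=> YL [_ us]; rewrite us. Qed.

Lemma equivariant_sum Y Z : commutant left_mult Y -> commutant left_mult Z ->
  commutant left_mult (fun x => Y x + Z x).
Proof. exact: (lin_closed_add (commutant_lin left_mult_linear)). Qed.

(** The associator [<a, c, x> = a'' c x] is linear over weight 0 in [c]. *)
Lemma associator_shift a b c x :
  associator op a (op b c) x = op b (associator op a c x).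
Proof.
rewrite assoc_shift /associator linearBr /=.
by rewrite (op_left_comm b) (op_left_comm b a) (op_left_comm b c).
Qed.

Lemma associator_equivariant a x : commutant left_mult (fun c => associator op a c x).
Proof.
apply: equivariantP => [k y z|b c]; last exact: associator_shift.
rewrite /associator op_linr !op_linl op_linr.
by rewrite scalerBr opprD addrACA.
Qed.

(** The relation [(a c) u' = a' (c u')].  It says
[<a, u c, x> = u <a, c, x>], which holds because [c |-> <a, c, x>] is
equivariant and [u] is in the bicommutant. *)
Lemma der_along_equivariant u x : scalar u -> commutant left_mult (fun c => der_along c u x).
Proof.
move=> us; apply: equivariantP => [|a c].
  exact: der_along_lin (scalar_linear us) x.
have ua y : u (op a y) = op a (u y) by rewrite (scalar_comm _ us (scalar_op a)).
have /eqP := equivariant_scalar c (associator_equivariant a x) us.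
rewrite /der_along /associator (linear_sub (scalar_linear us)) linearBr /= -ua subr_eq.
move=> /eqP ->; rewrite (ua (op c x)); set q := u (op _ x).
by rewrite addrAC [q - _]addrC addrK addrC.
Qed.

Lemma der_along_scalar u v c x : scalar u -> scalar v ->
  der_along (v c) u x = v (der_along c u x).
Proof. by move=> us; exact: (equivariant_scalar c (der_along_equivariant x us)). Qed.

(** The Leibniz rule [c (u v)' = v (c u') + u (c v')] amounts to
[(v c) u' = v (c u')]. *)
Lemma der_along_comp u v c x : scalar u -> scalar v ->
  der_along c (u \o v) x = v (der_along c u x) + u (der_along c v x).
Proof.
move=> us vs; rewrite -der_along_scalar // /der_along /= (linear_sub (scalar_linear us)).
by rewrite addrA subrK.
Qed.

Lemma der_along_null u z x : scalar u -> left_null z -> der_along z u x = 0.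
Proof.
move=> us zk; rewrite /der_along (left_null_op _ zk) (left_null_op _ (left_null_scalar us zk)).
by rewrite (linear_zero (scalar_linear us)) subrr.
Qed.

(** The element [der_along b (op a) c] is the associator [<a, b, c>].  A scalar
[u] moves into either of its last two arguments; hence the third identity,
applied to [<a, u b, c>], shows that [u (<a, b, c> - <a, c, b>)] has zero left
multiplication. *)
Lemma coefficient_op a : coefficient (op a).
Proof.
split=> [|b c u us x]; first exact: scalar_op.
have key y z : u (associator op a y z) = associator op a (u y) z.
  by rewrite (equivariant_scalar y (associator_equivariant a z) us).
have key2 y z : u (associator op a y z) = associator op a y (u z).
  rewrite /associator (linear_sub (scalar_linear us)).
  by rewrite !(scalar_comm _ us (scalar_op _)).
rewrite (linear_sub (scalar_linear us)) linearBl /= -!/(associator op a _ _).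
by rewrite key key2 assoc_sym subrr.
Qed.

Lemma coefficient_id : coefficient id.
Proof.
by split=> [|a b]; [exact: commutant_id | rewrite /der_along !subrr; exact: left_null_lin.1].
Qed.

Lemma coefficient_lin : lin_closed coefficient.
Proof.
have [s0 slin] := bicommutant_lin left_mult.
have der0 c : der_along c 0 = 0.
  by apply/funext => x; rewrite /der_along linear0l subrr.
split=> [|k u v [us uk] [vs vk]]; split; [exact: s0 | | exact: slin |] => a b.
  by rewrite !der0 subrr; exact: left_null_lin.1.
by rewrite !der_along_linr opprD addrACA -scalerBr; apply: left_null_lin.2.
Qed.

Lemma coefficient_comp u v : coefficient u -> coefficient v -> coefficient (u \o v).
Proof.
move=> [us uk] [vs vk]; split=> [|a b]; first exact: commutant_comp.
rewrite (der_along_comp a b us vs) (der_along_comp b a us vs) opprD addrACA.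
rewrite -(linear_sub (scalar_linear us)) -(linear_sub (scalar_linear vs)).
by apply: lin_closed_add left_null_lin _ _; apply: left_null_scalar.
Qed.

Lemma coefficient_der_along c u : coefficient u -> coefficient (der_along c u).
Proof.
move=> uc; rewrite (_ : der_along c u = op (u c) - (u \o op c)) //.
apply: (lin_closed_sub coefficient_lin); first exact: coefficient_op.
by apply: coefficient_comp => //; exact: coefficient_op.
Qed.

(** * Tensors of non-negative weight *)

Local Notation raw := (seq B -> B -> B).
Local Notation equivariant := (commutant left_mult).

(** Multiplication by [c], which lowers the weight by one. *)
Definition contract (c : B) (f : raw) : raw := fun P => f (c :: P).

(** The elements of weight [m] for all [m] at once: [f [:: c_1; ...; c_m]] is the
weight 0 operator [c_1 ... c_m f_m], where [f_m] is the component of weight [m].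
The field [tensor_exch] is the symmetry of [c_1 ... c_m f_m] under exchange of
some [c_i] with the argument of the operator; it reflects that the last
argument is one more factor. *)
Record tensor (f : raw) : Prop := Tensor {
  tensor_coef : forall P, coefficient (f P);
  tensor_swap : forall s a b P, f (s ++ a :: b :: P) = f (s ++ b :: a :: P);
  tensor_head : forall P x, equivariant (fun c => f (c :: P) x);
  tensor_null : forall P z x, left_null z -> f (z :: P) x = 0;
  tensor_exch : forall P a b, left_null (f (a :: P) b - f (b :: P) a) }.

Lemma tensor_scalar f P : tensor f -> scalar (f P).
Proof. by move=> /tensor_coef /(_ P) []. Qed.

Lemma tensor_linear f P : tensor f -> linear (f P).
Proof. by move=> /(tensor_scalar P) /scalar_linear. Qed.

Lemma tensor_swap2 f a b P : tensor f -> f (a :: b :: P) = f (b :: a :: P).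
Proof. by move=> ft; exact: (tensor_swap ft [::]). Qed.

Lemma contract_swap f a b : tensor f -> contract a (contract b f) = contract b (contract a f).
Proof. by move=> ft; apply/funext => P; exact: tensor_swap2. Qed.

Lemma tensor_lin : lin_closed tensor.
Proof.
split=> [|k f g ft gt]; split.
- by move=> P; exact: coefficient_lin.1.
- by [].
- by move=> P x; exact: (commutant_lin left_mult_linear).1.
- by [].
- by move=> P a b; rewrite [X in left_null X]subrr; exact: left_null_lin.1.
- by move=> P; apply: coefficient_lin.2; exact: tensor_coef.
- by move=> s a b P; rewrite !linfctE !(tensor_swap _ s a).
- move=> P x.
  exact: (commutant_lin left_mult_linear).2 (tensor_head ft P x) (tensor_head gt P x).
- by move=> P z x zk; rewrite !linfctE !tensor_null // scaler0 addr0.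
- move=> P a b; rewrite !linfctE opprD addrACA -scalerBr.
  by apply: left_null_lin.2; exact: tensor_exch.
Qed.

Lemma tensor_contract c f : tensor f -> tensor (contract c f).
Proof.
move=> ft; split; rewrite /contract.
- by move=> P; exact: tensor_coef.
- by move=> s a b P; exact: (tensor_swap ft (c :: s)).
- move=> P x; have := tensor_head ft (c :: P) x.
  by under eq_fun do rewrite tensor_swap2 //.
- by move=> P z x zk; rewrite tensor_swap2 // tensor_null.
- by move=> P a b; rewrite !(tensor_swap2 c) //; exact: tensor_exch.
Qed.

Lemma tensor_head_scalar f u c P x : tensor f -> scalar u ->
  f (u c :: P) x = u (f (c :: P) x).
Proof. by move=> ft; exact: (equivariant_scalar c (tensor_head ft P x)). Qed.

(** Factors can be exchanged between two tensors: move the value of [f] into an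
argument of [g] by linearity, exchange there, and move it out again. *)
Lemma tensor_exchange f g a b P Q x : tensor f -> tensor g ->
  f (a :: P) (g (b :: Q) x) = f (b :: P) (g (a :: Q) x).
Proof.
move=> ft gt; have sf c R : scalar (f (c :: R)) := tensor_scalar _ ft.
rewrite -(tensor_head_scalar b Q x gt (sf a P)) -(tensor_head_scalar a Q x gt (sf b P)).
apply/eqP; rewrite -subr_eq0 -(linear_sub (tensor_head gt Q x).1).
by rewrite (tensor_null gt) //; exact: tensor_exch.
Qed.

(** The product of tensors: the component of weight [m + n] of [f g] is obtained
by feeding the first [m] letters to [f] and the other [n] to [g], so that
[conv f g] sums over all cuts of the list.  The order of the letters is
immaterial because of [tensor_exchange]. *)
Fixpoint conv (f g : raw) (P : seq B) : B -> B :=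
  match P with
  | [::] => f [::] \o g [::]
  | c :: Q => (f [::] \o g (c :: Q)) + conv (contract c f) g Q
  end.

Lemma conv_cons f g c P x :
  conv f g (c :: P) x = f [::] (g (c :: P) x) + conv (contract c f) g P x.
Proof. by []. Qed.

Lemma conv_linl g P x : linear (fun f => conv f g P x).
Proof.
move=> a f f'; elim: P f f' => [//|c P IH] f f'.
rewrite !conv_cons [contract _ _]/(_ *: contract c f + contract c f').
by rewrite IH !linfctE scalerDr addrACA.
Qed.

Lemma conv_linr f P x : (forall Q, linear (f Q)) -> linear (fun g => conv f g P x).
Proof.
move=> + a g g'; elim: P f => [|c P IH] f flin; first by rewrite /= flin.
rewrite !conv_cons IH ?linfctE ?flin; last by move=> Q; exact: flin.
by rewrite scalerDr addrACA.
Qed.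

Lemma conv0 f g P x : (forall Q y, f Q y = 0) -> conv f g P x = 0.
Proof.
elim: P f => [|c P IH] f f0; first exact: f0.
by rewrite conv_cons f0 add0r IH // => Q y; exact: f0.
Qed.

(** The argument [c] of [contract c f] is generalised to an arbitrary family,
since the recursion of [conv] contracts the tensor further. *)
Lemma conv_equivariant (F : B -> raw) g P x :
  (forall Q y, equivariant (fun c => F c Q y)) ->
  equivariant (fun c => conv (F c) g P x).
Proof.
elim: P F => [|p P IH] F Fe; first exact: Fe.
by apply: equivariant_sum (Fe _ _) _; apply: IH => Q y; exact: Fe.
Qed.

Lemma conv_coef f g P : (forall Q, coefficient (f Q)) -> (forall Q, coefficient (g Q)) ->
  coefficient (conv f g P).
Proof.
move=> fc gc; elim: P f fc => [|c P IH] f fc; first exact: coefficient_comp.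
apply: (lin_closed_add coefficient_lin); first exact: coefficient_comp.
by apply: IH => Q; exact: fc.
Qed.

Lemma conv_exch f1 f2 g a b P : (forall Q, scalar (f1 Q)) -> (forall Q, scalar (f2 Q)) ->
  (forall Q, scalar (g Q)) -> (forall Q, left_null (f1 Q b - f2 Q a)) ->
  left_null (conv f1 g P b - conv f2 g P a).
Proof.
move=> s1 s2 sg; elim: P f1 f2 s1 s2 => [|c P IH] f1 f2 s1 s2 fk.
  rewrite /= (scalar_comm b (s1 _) (sg _)) (scalar_comm a (s2 _) (sg _)).
  rewrite -(linear_sub (scalar_linear (sg _))).
  exact: left_null_scalar.
rewrite !conv_cons opprD addrACA; apply: (lin_closed_add left_null_lin).
  rewrite /= (scalar_comm b (s1 _) (sg _)) (scalar_comm a (s2 _) (sg _)).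
  rewrite -(linear_sub (scalar_linear (sg _))).
  exact: left_null_scalar.
by apply: IH => Q; [exact: s1 | exact: s2 | exact: fk].
Qed.

Lemma conv_swap f g s a b P : tensor f -> tensor g ->
  conv f g (s ++ a :: b :: P) = conv f g (s ++ b :: a :: P).
Proof.
move=> ft gt; elim: s f ft => [|c s IH] f ft; apply/funext => x.
  rewrite !cat0s !conv_cons (tensor_swap2 _ _ _ gt) (contract_swap a b ft).
  by rewrite /contract (tensor_exchange a b [::] P x ft gt).
rewrite !cat_cons !conv_cons (IH _ (tensor_contract c ft)).
by rewrite -!cat_cons (tensor_swap gt).
Qed.

Lemma tensor_conv f g : tensor f -> tensor g -> tensor (conv f g).
Proof.
move=> ft gt; split.
- by move=> P; apply: conv_coef; exact: tensor_coef.
- by move=> s a b P; exact: conv_swap.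
- move=> P x; apply: equivariant_sum.
    exact: commutant_comp (scalar_equivariant (tensor_scalar [::] ft)) (tensor_head gt P x).
  by apply: conv_equivariant => Q y; exact: tensor_head.
- move=> P z x zk; rewrite conv_cons (tensor_null gt) // (linear_zero (tensor_linear _ ft)) add0r.
  by apply: conv0 => Q y; exact: tensor_null.
- move=> P a b; rewrite !conv_cons opprD addrACA; apply: (lin_closed_add left_null_lin).
    rewrite -(linear_sub (tensor_linear _ ft)); apply: left_null_scalar; first exact: tensor_scalar.
    exact: tensor_exch.
  by apply: conv_exch => Q; rewrite /contract;
    [exact: tensor_scalar | exact: tensor_scalar | exact: tensor_scalar | exact: tensor_exch].
Qed.

Lemma raw_subE (f g : raw) P x : (f - g) P x = f P x - g P x.
Proof. by []. Qed.

Lemma raw_addE (f g : raw) P x : (f + g) P x = f P x + g P x.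
Proof. by []. Qed.

(** The letter [c] can be fed to either factor; [conv] by definition feeds it to
the left one.  The induction moves [c] past the next letter by symmetry of the
product. *)
Lemma conv_contractr f g c P x : tensor f -> tensor g ->
  conv f g (c :: P) x = conv f (contract c g) P x + g [::] (f (c :: P) x).
Proof.
move=> ft gt; elim: P f ft => [|b P IH] f ft.
  rewrite conv_cons /= /contract.
  by rewrite (scalar_comm x (tensor_scalar [:: c] ft) (tensor_scalar [::] gt)).
rewrite -[conv f g (c :: _)](conv_swap [::] b c P ft gt) cat0s conv_cons.
rewrite (IH _ (tensor_contract b ft)) conv_cons.
by rewrite addrA /contract (tensor_swap2 b c P ft) (tensor_swap2 b c P gt).
Qed.

Lemma convC f g : tensor f -> tensor g -> conv f g = conv g f.
Proof.
move=> ft gt; apply/funext => P; apply/funext => x.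
elim: P f ft => [|c P IH] f ft.
  exact: (scalar_comm x (tensor_scalar [::] ft) (tensor_scalar [::] gt)).
rewrite conv_cons (conv_contractr c P x gt ft) addrC.
by rewrite (IH _ (tensor_contract c ft)).
Qed.

Lemma conv_compl u f g P x : linear u ->
  conv (fun Q => u \o f Q) g P x = u (conv f g P x).
Proof.
move=> ulin; elim: P f => [//|c P IH] f.
by rewrite !conv_cons (linear_add ulin) -IH.
Qed.

Lemma convA f g h : tensor f -> tensor g -> tensor h ->
  conv (conv f g) h = conv f (conv g h).
Proof.
move=> ft gt ht; apply/funext => P; apply/funext => x.
elim: P f ft => [//|c P IH] f ft.
have fl := tensor_linear [::] ft.
rewrite conv_cons [in RHS]conv_cons conv_cons (linear_add fl) -addrA; congr (_ + _).
rewrite -IH; last exact: tensor_contract.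
rewrite -(conv_compl (contract c g) h P x fl).
exact: (linear_add (conv_linl h P x) (fun Q => f [::] \o contract c g Q) (conv (contract c f) g)).
Qed.

Definition const_tensor (u : B -> B) : raw := fun P => if P is [::] then u else 0.

Lemma tensor_const u : coefficient u -> tensor (const_tensor u).
Proof.
move=> uc; split.
- by case=> [|? ?] //; exact: coefficient_lin.1.
- by case.
- by move=> P x; exact: (commutant_lin left_mult_linear).1.
- by [].
- by move=> P a b; rewrite [X in left_null X]subrr; exact: left_null_lin.1.
Qed.

Lemma conv_const u f P x : conv (const_tensor u) f P x = u (f P x).
Proof. by case: P => [//|c P]; rewrite conv_cons conv0 // addr0. Qed.

(** The sum over the letters [q] of [P] of [op q (f (P minus q))]: the terms
[q' ...] that arise when the product of the letters of [P] with [f] is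
differentiated. *)
Fixpoint esum (f : raw) (P : seq B) : B -> B :=
  if P is q :: Q then (op q \o f Q) + esum (contract q f) Q else 0.

Lemma esum_cons f q P x : esum f (q :: P) x = op q (f P x) + esum (contract q f) P x.
Proof. by []. Qed.

Lemma esum_lin P x : linear (fun f => esum f P x).
Proof.
move=> a f g; elim: P f g => [|q P IH] f g; first by rewrite /= scaler0 addr0.
rewrite !esum_cons [contract _ _]/(a *: contract q f + contract q g).
by rewrite IH linfctE op_linr scalerDr addrACA.
Qed.

Lemma esum0 f P x : (forall Q y, f Q y = 0) -> esum f P x = 0.
Proof.
elim: P f => [//|q P IH] f f0.
by rewrite esum_cons f0 linear0r add0r IH // => Q y; exact: f0.
Qed.

Lemma esum_coef f P : (forall Q, coefficient (f Q)) -> coefficient (esum f P).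
Proof.
elim: P f => [|q P IH] f fc; first exact: coefficient_lin.1.
apply: (lin_closed_add coefficient_lin); last by apply: IH => Q; exact: fc.
by apply: coefficient_comp => //; exact: coefficient_op.
Qed.

Lemma op_equivariant q : equivariant (op q).
Proof. exact: scalar_equivariant (scalar_op q). Qed.

Lemma esum_equivariant (F : B -> raw) P x :
  (forall Q y, equivariant (fun c => F c Q y)) -> equivariant (fun c => esum (F c) P x).
Proof.
elim: P F => [|q P IH] F Fe; first exact: (commutant_lin left_mult_linear).1.
apply: equivariant_sum; last by apply: IH => Q y; exact: Fe.
exact: commutant_comp (op_equivariant q) (Fe _ _).
Qed.

Lemma esum_exch f1 f2 a b P : (forall Q, left_null (f1 Q b - f2 Q a)) ->
  left_null (esum f1 P b - esum f2 P a).
Proof.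
elim: P f1 f2 => [|q P IH] f1 f2 fk; first by rewrite subrr; exact: left_null_lin.1.
rewrite !esum_cons opprD addrACA; apply: (lin_closed_add left_null_lin).
  by rewrite -linearBr; apply: left_null_scalar => //; exact: scalar_op.
by apply: IH => Q; exact: fk.
Qed.

Lemma esum_swap f s a b P : tensor f -> esum f (s ++ a :: b :: P) = esum f (s ++ b :: a :: P).
Proof.
elim: s f => [|q s IH] f ft; apply/funext => x; rewrite ?cat0s ?cat_cons !esum_cons.
  by rewrite (contract_swap a b ft) addrCA.
by rewrite (tensor_swap ft) IH //; exact: tensor_contract.
Qed.

(** The derivative, from
[c Q f' = c (Q f)' - \sum_(q in Q) q' c (Q minus q) f] for a product [Q] of
letters.  The value at [nil] is 0, since a derivative has positive weight. *)
Definition der (f : raw) : raw := fun P =>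
  if P is c :: Q then der_along c (f Q) - esum (contract c f) Q else 0.

Lemma der_cons f c P x :
  der f (c :: P) x = der_along c (f P) x - esum (contract c f) P x.
Proof. by []. Qed.

Lemma tensor_der f : tensor f -> tensor (der f).
Proof.
move=> ft; split.
- case=> [|c P]; first exact: coefficient_lin.1.
  apply: (lin_closed_sub coefficient_lin).
    by apply: coefficient_der_along; exact: tensor_coef.
  by apply: esum_coef => Q; exact: (tensor_coef ft).
- case=> [|c s] a b P; apply/funext => x; rewrite ?cat0s ?cat_cons !der_cons; last first.
    by rewrite (tensor_swap ft) (esum_swap s a b P (tensor_contract c ft)).
  (* For the first two letters, what is left is
  [op (f (b P) a) x - op a (f (b P) x) - op b (f (a P) x)], whose symmetry in [a]
  and [b] is [tensor_exch] followed by a left multiplication. *)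
  rewrite !esum_cons (contract_swap a b ft) !opprD !addrA; congr (_ - _).
  rewrite /der_along /contract !(scalar_comm x (tensor_scalar _ ft) (scalar_op _)).
  rewrite -!addrA -!opprD [op b _ + _]addrC; congr (_ - _).
  apply/eqP; rewrite -subr_eq0 -linearBl left_null_op //.
  exact: tensor_exch.
- move=> P x; apply: (lin_closed_sub (commutant_lin left_mult_linear)).
    by apply: der_along_equivariant; exact: tensor_scalar.
  by apply: esum_equivariant => Q y; exact: (tensor_head ft).
- move=> P z x zk; rewrite der_cons (der_along_null x (tensor_scalar P ft) zk) sub0r.
  by rewrite esum0 ?oppr0 // => Q y; exact: (tensor_null ft).
- move=> P a b; rewrite !der_cons opprD addrACA -opprD.
  apply: (lin_closed_sub left_null_lin); first exact: (tensor_coef ft P).2.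
  by apply: esum_exch => Q; exact: (tensor_exch ft).
Qed.

Lemma der_lin P x : linear (fun f => der f P x).
Proof.
move=> a f g; case: P => [|c P]; first by rewrite /= scaler0 addr0.
rewrite !der_cons linfctE der_along_linr (esum_lin P x a (contract c f)).
by rewrite opprD scalerBr addrACA.
Qed.

(** The Leibniz rule [c f' = (c f)' - c' f].  For a component [u] of weight 0
the product [c u] is no longer a tensor, hence the hypothesis. *)
Lemma contract_der f c : tensor f -> f [::] = 0 ->
  contract c (der f) = der (contract c f) - conv (const_tensor (op c)) f.
Proof.
move=> ft f0; apply/funext => P; apply/funext => x.
rewrite raw_subE conv_const /contract.
case: P => [|q P].
  by rewrite der_cons f0 /der_along /= linear0l linear0r !subr0.
rewrite (tensor_swap2 c q P (tensor_der ft)) !der_cons esum_cons opprD addrA addrAC.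
by rewrite -/(contract q (contract c f)) (contract_swap q c ft).
Qed.

Lemma der_along_conv f g c P x :
  (forall Q, coefficient (f Q)) -> (forall Q, coefficient (g Q)) ->
  der_along c (conv f g P) x =
  conv (fun Q => der_along c (f Q)) g P x + conv f (fun Q => der_along c (g Q)) P x.
Proof.
move=> fc gc.
have comp u v : coefficient u -> coefficient v ->
    der_along c (u \o v) x = der_along c u (v x) + u (der_along c v x).
  move=> uc vc; rewrite (der_along_comp c x (proj1 uc) (proj1 vc)).
  by rewrite (scalar_comm x (proj1 vc) (proj1 (coefficient_der_along c uc))).
elim: P f fc => [|q P IH] f fc; first exact: comp.
rewrite !conv_cons addrACA -comp // -(IH (contract q f)) => [|Q]; last exact: fc.
have := der_along_linr c x 1 (f [::] \o g (q :: P)) (conv (contract q f) g P).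
by rewrite !scale1r.
Qed.

Lemma esum_compl u f P x : scalar u ->
  esum (fun Q => u \o f Q) P x = u (esum f P x).
Proof.
move=> us; have ul := scalar_linear us; elim: P f => [|q P IH] f.
  by rewrite /= (linear_zero ul).
rewrite !esum_cons (linear_add ul) -IH; congr (_ + _).
by rewrite (scalar_comm _ us (scalar_op q)).
Qed.

(** Both sides remove one letter from the list and cut the rest.  The letter [c]
is needed to absorb the shift between the two ways to cut: if the removed
letter is to the right of the cut, [c] goes to [g] and [f] takes one letter
more. *)
Lemma esum_conv f g c P x : tensor f -> tensor g ->
  esum (contract c (conv f g)) P x =
  conv (esum (contract c f)) g P x + conv f (esum (contract c g)) P x.
Proof.
move=> ft gt; elim: P f ft => [|q P IH] f ft; have fl Q := tensor_linear Q ft.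
  by rewrite /= (linear_zero (fl _)) addr0.
have lhs : esum (contract q (contract c (conv f g))) P x =
    f [::] (esum (contract c (contract q g)) P x) +
    esum (contract c (conv (contract q f) g)) P x.
  rewrite (contract_swap q c (tensor_conv ft gt)) -(esum_compl _ P x (tensor_scalar [::] ft)).
  exact: (linear_add (esum_lin P x) (fun Q => f [::] \o contract c (contract q g) Q)
           (contract c (conv (contract q f) g))).
have rhs : conv (contract q (esum (contract c f))) g P x =
    op q (conv (contract c f) g P x) + conv (esum (contract q (contract c f))) g P x.
  rewrite -(conv_compl (contract c f) g P x (op_linr q)).
  exact: (linear_add (conv_linl g P x) (fun Q => op q \o contract c f Q)
           (esum (contract q (contract c f)))).
rewrite esum_cons lhs (IH _ (tensor_contract q ft)).
rewrite [X in _ = X + _]conv_cons [X in _ = _ + X]conv_cons add0r rhs esum_cons.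
rewrite [contract c (conv f g) P x]conv_cons (linear_add (op_linr q)) (linear_add (fl _)).
rewrite (contract_swap q c ft) (contract_swap q c gt).
rewrite (scalar_comm _ (tensor_scalar [::] ft) (scalar_op q)) /=.
set a := op q (f _ _); set b := op q (conv _ _ _ _).
by rewrite -!addrA addrCA; congr (_ + _); rewrite [RHS]addrCA; congr (_ + _); rewrite addrCA.
Qed.

Lemma der_conv f g : tensor f -> tensor g ->
  der (conv f g) = conv (der f) g + conv f (der g).
Proof.
move=> ft gt; apply/funext => P; apply/funext => x.
have fl Q := tensor_linear Q ft.
rewrite raw_addE.
case: P => [|c P]; first by rewrite /= (linear_zero (fl _)) addr0.
rewrite der_cons (conv_contractr c P x ft (tensor_der gt)) conv_cons addr0 add0r.
rewrite der_along_conv ?esum_conv //; [|exact: tensor_coef ..].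
rewrite opprD addrACA; congr (_ + _).
  exact/esym/(linear_sub (conv_linl g P x) (fun Q => der_along c (f Q)) (esum (contract c f))).
exact/esym/(linear_sub (conv_linr P x fl) (fun Q => der_along c (g Q)) (esum (contract c g))).
Qed.

(** * The representation on functionals *)

Definition tensors := subspace tensor_lin.

Definition tconv (f g : tensors) : tensors :=
  insubspace tensor_lin (tensor_conv (subspaceP f) (subspaceP g)).

Definition tder (f : tensors) : tensors :=
  insubspace tensor_lin (tensor_der (subspaceP f)).

Definition tcontract (c : B) (f : tensors) : tensors :=
  insubspace tensor_lin (tensor_contract c (subspaceP f)).

Definition tconst (u : B -> B) (uc : coefficient u) : tensors :=
  insubspace tensor_lin (tensor_const uc).

(** The tensor [a']. *)
Notation top a := (tconst (coefficient_op a)).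

Lemma tconvC f g : tconv f g = tconv g f.
Proof. by apply: val_inj; exact: convC (subspaceP f) (subspaceP g). Qed.

Lemma tconvA f g h : tconv (tconv f g) h = tconv f (tconv g h).
Proof. by apply: val_inj; exact: convA (subspaceP f) (subspaceP g) (subspaceP h). Qed.

Lemma tconvCA f g h : tconv f (tconv g h) = tconv g (tconv f h).
Proof. by rewrite -!tconvA (tconvC f). Qed.

Lemma tconv_linl g : linear (fun f => tconv f g).
Proof.
move=> a f f'; apply: val_inj; rewrite subspace_lin.
apply/funext => P; apply/funext => x.
rewrite [LHS]/(conv (val (a *: f + f')) (val g) P x) subspace_lin.
exact: (conv_linl (val g) P x a (val f) (val f')).
Qed.

Lemma tconv_linr f : linear (tconv f).
Proof. by move=> a g g'; rewrite !(tconvC f); exact: tconv_linl. Qed.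

Lemma tder_lin : linear tder.
Proof.
move=> a f g; apply: val_inj; rewrite subspace_lin.
apply/funext => P; apply/funext => x.
rewrite [LHS]/(der (val (a *: f + g)) P x) subspace_lin.
exact: (der_lin P x a (val f) (val g)).
Qed.

Lemma tder_conv f g : tder (tconv f g) = tconv (tder f) g + tconv f (tder g).
Proof.
apply: val_inj; rewrite (linear_add (fun a x y => subspace_lin a x y)).
exact: der_conv (subspaceP f) (subspaceP g).
Qed.

Lemma tcontract_der f c : val f [::] = 0 ->
  tcontract c (tder f) = tder (tcontract c f) - tconv (top c) f.
Proof.
move=> f0; apply: val_inj; rewrite (linear_sub (fun a x y => subspace_lin a x y)).
exact: contract_der (subspaceP f) f0.
Qed.

Lemma tconv_vanish f g : val f [::] = 0 -> val (tconv g f) [::] = 0.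
Proof.
move=> f0; apply/funext => x; change (val g [::] (val f [::] x) = 0); rewrite f0.
exact: linear_zero (tensor_linear _ (subspaceP g)).
Qed.

Lemma tcontract_conv f g c : val f [::] = 0 ->
  tcontract c (tconv g f) = tconv g (tcontract c f).
Proof.
move=> f0; apply: val_inj; apply/funext => P; apply/funext => x.
rewrite [LHS](conv_contractr c P x (subspaceP g) (subspaceP f)).
by rewrite f0 addr0.
Qed.

(** The equation [c a'' = (a' c)' - a' c']. *)
Lemma tcontract_der_op a c :
  tcontract c (tder (top a)) = top (op a c) - tconv (top a) (top c).
Proof.
apply: val_inj; rewrite (linear_sub (fun k x y => subspace_lin k x y)).
apply/funext => P; apply/funext => x; rewrite raw_subE.
change (der (const_tensor (op a)) (c :: P) x = const_tensor (op (op a c)) P x -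
  conv (const_tensor (op a)) (const_tensor (op c)) P x).
rewrite der_cons conv_const esum0 // subr0.
by case: P => [//|p P]; rewrite /der_along /= linear0l linear0r.
Qed.

Definition functional_space := seq B -> tensors -> B.

Definition prepend (c : B) (F : functional_space) : functional_space :=
  fun P => F (c :: P).

(** Together with [prepend], the action of the algebra [C] on its functionals. *)
Definition tmul (g : tensors) (F : functional_space) : functional_space :=
  fun P f => F P (tconv g f).

(** The functional [- F \o d], where [d] differentiates a product of letters and
a tensor.  Peeling the letters off one at a time makes the equation
[[d, c] = c'] hold by definition. *)
Fixpoint fder_at (P : seq B) (F : functional_space) : tensors -> B :=
  match P with
  | [::] => fun f => - F [::] (tder f)
  | c :: Q => fun f => fder_at Q (prepend c F) f - F Q (tconv (top c) f)
  end.

Definition fder (F : functional_space) : functional_space := fder_at^~ F.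

Lemma fder_cons c F P f :
  fder F (c :: P) f = fder (prepend c F) P f - F P (tconv (top c) f).
Proof. by []. Qed.

(** The value [F [:: c_1; ...; c_k] f] is that of a linear functional at
[c_1 ... c_k f].  The last two fields say that the functional respects the
relation [c f = contract c f] in positive weight and the relation
[a > c = a' c] on generators. *)
Record functional (F : functional_space) : Prop := Functional {
  functional_linear : forall P, linear (F P);
  functional_swap : forall s a b P, F (s ++ a :: b :: P) = F (s ++ b :: a :: P);
  functional_head : forall P f, linear (fun c => F (c :: P) f);
  functional_contract : forall c P f, val f [::] = 0 ->
    F (c :: P) f = F P (tcontract c f);
  functional_balanced : forall a c P f,
    F (op a c :: P) f = F (c :: P) (tconv (top a) f) }.

Lemma functional_lin : lin_closed functional.
Proof.
split=> [|k F G Ff Gf]; split.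
- by move=> P a f g; rewrite [RHS]addr0 scaler0.
- by [].
- by move=> P f a c c'; rewrite [RHS]addr0 scaler0.
- by [].
- by [].
- move=> P a f g; rewrite !linfctE (functional_linear Ff) (functional_linear Gf).
  by rewrite !scalerDr !scalerA addrACA [k * a]mulrC.
- by move=> s a b P; rewrite !linfctE !(functional_swap _ s a).
- move=> P f a c c'; rewrite !linfctE (functional_head Ff) (functional_head Gf).
  by rewrite !scalerDr !scalerA addrACA [k * a]mulrC.
- by move=> c P f f0; rewrite !linfctE !functional_contract.
- by move=> a c P f; rewrite !linfctE !functional_balanced.
Qed.

Lemma functional_swap2 F a b P : functional F -> F (a :: b :: P) = F (b :: a :: P).
Proof. by move=> Ff; exact: (functional_swap Ff [::]). Qed.

Lemma prepend_swap F a b : functional F ->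
  prepend a (prepend b F) = prepend b (prepend a F).
Proof. by move=> Ff; apply/funext => P; exact: functional_swap2. Qed.

Lemma functional_prepend c F : functional F -> functional (prepend c F).
Proof.
move=> Ff; split; rewrite /prepend.
- by move=> P; exact: functional_linear.
- by move=> s a b P; exact: (functional_swap Ff (c :: s)).
- move=> P f; have := functional_head Ff (c :: P) f.
  by under eq_fun do rewrite functional_swap2 //.
- by move=> b P f f0; rewrite functional_swap2 // functional_contract.
- by move=> a b P f; rewrite !(functional_swap2 c) // functional_balanced.
Qed.

Lemma functional_tmul g F : functional F -> functional (tmul g F).
Proof.
move=> Ff; split; rewrite /tmul.
- by move=> P a f f'; rewrite tconv_linr (functional_linear Ff).
- by move=> s a b P; rewrite (functional_swap Ff).
- by move=> P f; exact: functional_head.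
- move=> c P f f0; rewrite functional_contract ?tconv_vanish //.
  by rewrite tcontract_conv.
- by move=> a c P f; rewrite (functional_balanced Ff) tconvCA.
Qed.

Lemma top_lin k a b : top (k *: a + b) = k *: top a + top b.
Proof.
apply: val_inj; rewrite subspace_lin; apply/funext => P; apply/funext => x.
case: P => [|p P]; first exact: op_linl.
by change (0 = k *: (0 : B) + 0); rewrite scaler0 addr0.
Qed.

(** Linearity in the first letter, with [prepend c F] generalised to a family
since the recursion of [fder] prepends further letters. *)
Lemma fder_family (F : B -> functional_space) P f :
  (forall c, functional (F c)) -> (forall Q g, linear (fun c => F c Q g)) ->
  linear (fun c => fder (F c) P f).
Proof.
elim: P F => [|p P IH] F Ff Flin a c c'.
  by rewrite /fder /= Flin opprD scalerN.
rewrite !fder_cons Flin opprD scalerBr addrACA; congr (_ + _).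
by apply: (IH (fun c => prepend p (F c))) => [b|Q g]; [exact: functional_prepend | exact: Flin].
Qed.

Lemma functional_fder F : functional F -> functional (fder F).
Proof.
move=> Ff; split.
- move=> P; elim: P F Ff => [|p P IH] F Ff a f g.
    by rewrite /fder /= tder_lin (functional_linear Ff) opprD scalerN.
  rewrite !fder_cons IH; last exact: functional_prepend.
  by rewrite tconv_linr (functional_linear Ff) opprD scalerBr addrACA.
- move=> s a b P; apply/funext => f.
  elim: s F Ff => [|c s IH] F Ff; rewrite ?cat0s ?cat_cons !fder_cons.
    rewrite (prepend_swap a b Ff) /prepend -!addrA; congr (_ + _).
    by rewrite addrC.
  by rewrite (functional_swap Ff) (IH _ (functional_prepend c Ff)).
- move=> P f a c c'; rewrite !fder_cons.
  have lin := fder_family P f (fun b => functional_prepend b Ff) (functional_head Ff).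
  rewrite (lin a c c') top_lin tconv_linl (functional_linear Ff) opprD scalerBr.
  by rewrite addrACA.
- move=> c P f f0; rewrite fder_cons.
  elim: P F Ff => [|p P IH] F Ff.
    rewrite /fder /= /prepend (functional_contract Ff) // tcontract_der //.
    by rewrite (linear_sub (functional_linear Ff _)) opprB addrAC subrr sub0r.
  rewrite !fder_cons (prepend_swap p c Ff) addrAC IH; last exact: functional_prepend.
  congr (_ - _); rewrite /prepend (functional_contract Ff) ?tconv_vanish //.
  by rewrite tcontract_conv.
- move=> a c P f; rewrite !fder_cons.
  elim: P F Ff => [|p P IH] F Ff.
    rewrite /fder /= /prepend (functional_balanced Ff) tder_conv.
    rewrite (linear_add (functional_linear Ff _)) [tconv (tder _) f]tconvC.
    (* Differentiating [a' f] produces [c a'' f], which is contracted to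
    [((a > c)' - a' c') f] in weight 0. *)
    rewrite [X in - (X + _)](functional_contract Ff) ?tconv_vanish //.
    rewrite tcontract_conv // tcontract_der_op (linear_sub (tconv_linr f)).
    rewrite (linear_sub (functional_linear Ff _)) !(tconvC f) -tconvA (tconvC (top c)).
    by rewrite !opprD opprK [- _ + _ - _]addrAC addrK addrC.
  rewrite !fder_cons !(prepend_swap p _ Ff) ![_ - _ - F (p :: P) _]addrAC.
  rewrite (IH _ (functional_prepend p Ff)) /prepend (functional_balanced Ff).
  by rewrite [tconv (top a) (tconv (top p) f)]tconvCA.
Qed.

Definition functionals := subspace functional_lin.

Definition nu (c : B) (F : functionals) : functionals :=
  insubspace functional_lin (functional_prepend c (subspaceP F)).

Definition mu (g : tensors) (F : functionals) : functionals :=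
  insubspace functional_lin (functional_tmul g (subspaceP F)).

Definition delta (F : functionals) : functionals :=
  insubspace functional_lin (functional_fder (subspaceP F)).

(** The component of weight 0 of [P f], applied to [x]: as [f P] only sees the
component of [f] whose weight is the number of letters of [P], all other weights
are sent to 0. *)
Definition eval_at (x : B) : functional_space := fun P f => val f P x.

Fact functional_eval_at x : functional (eval_at x).
Proof.
split; rewrite /eval_at.
- by move=> P a f g; rewrite subspace_lin.
- by move=> s a b P; apply/funext => f; rewrite (tensor_swap (subspaceP f)).
- by move=> P f; exact: (tensor_head (subspaceP f) P x).1.
- by [].
- move=> a c P f; rewrite [RHS]conv_const.
  exact: tensor_head_scalar (subspaceP f) (scalar_op a).
Qed.

Definition psi (x : B) : functionals := insubspace functional_lin (functional_eval_at x).

Lemma functionals_eq (F G : functionals) :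
  (forall P f, val F P f = val G P f) -> F = G.
Proof.
by move=> FG; apply: val_inj; apply/funext => P; apply/funext => f; exact: FG.
Qed.

Lemma val_functionals_sub (F G : functionals) P f :
  val (F - G) P f = val F P f - val G P f.
Proof. by rewrite (linear_sub (fun a x y => subspace_lin a x y)). Qed.

Lemma fder_lin P f : linear (fun F => fder F P f).
Proof.
move=> a F G; elim: P F G => [|p P IH] F G.
  by rewrite /fder /= linfctE opprD scalerN.
rewrite !fder_cons (IH (prepend p F) (prepend p G)) linfctE opprD scalerBr.
by rewrite addrACA.
Qed.

Lemma delta_lin : linear delta.
Proof.
move=> a F G; apply: functionals_eq => P f; rewrite subspace_lin.
change (fder (val (a *: F + G)) P f = a *: fder (val F) P f + fder (val G) P f).
by rewrite subspace_lin; exact: fder_lin.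
Qed.

Lemma nu_linear c : linear (nu c).
Proof.
move=> a F G; apply: functionals_eq => P f; rewrite subspace_lin.
change (val (a *: F + G) (c :: P) f = a *: val F (c :: P) f + val G (c :: P) f).
by rewrite subspace_lin.
Qed.

Lemma mu_linear g : linear (mu g).
Proof.
move=> a F G; apply: functionals_eq => P f; rewrite subspace_lin.
change (val (a *: F + G) P (tconv g f) =
  a *: val F P (tconv g f) + val G P (tconv g f)).
by rewrite subspace_lin.
Qed.

Lemma nu_lin : linear nu.
Proof.
move=> a b c; apply/funext => F; apply: functionals_eq => P f.
rewrite linfctE subspace_lin; exact: (functional_head (subspaceP F) P f a b c).
Qed.

Lemma ad_nu c : ad delta (nu c) = mu (top c).
Proof.
apply/funext => F; apply: functionals_eq => P f; rewrite val_functionals_sub.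
change (fder (prepend c (val F)) P f - fder (val F) (c :: P) f = val F P (tconv (top c) f)).
by rewrite fder_cons subKr.
Qed.

Lemma fder_tmul g F P f : functional F ->
  fder (tmul g F) P f - fder F P (tconv g f) = F P (tconv (tder g) f).
Proof.
move=> Ff; elim: P F Ff => [|p P IH] F Ff.
  rewrite /fder /= /tmul tder_conv (linear_add (functional_linear Ff _)).
  by rewrite opprK addrCA addNr addr0.
rewrite !fder_cons {2}/tmul (tconvCA g) opprB addrA subrK.
exact: (IH _ (functional_prepend p Ff)).
Qed.

Lemma ad_mu g : ad delta (mu g) = mu (tder g).
Proof.
apply/funext => F; apply: functionals_eq => P f; rewrite val_functionals_sub.
exact: fder_tmul (subspaceP F).
Qed.

(** This set of operators is stable under [ad], whereas the operators [nu c]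
alone are not. *)
Definition multiplier (X : functionals -> functionals) : Prop :=
  (exists c, X = nu c) \/ (exists g, X = mu g).

Lemma in_DerPerm_succ_of_identities : in_DerPerm_succ op.
Proof.
apply: (@in_DerPerm_succ_of_representation K functionals multiplier delta _ _ _ _ B op nu psi).
- by move=> X [[c ->]|[g ->]]; [exact: nu_linear | exact: mu_linear].
- move=> X Y [[c ->]|[g ->]] [[c' ->]|[g' ->]] F; apply: functionals_eq => P f.
  + by change (val F (c' :: c :: P) f = val F (c :: c' :: P) f);
      rewrite (functional_swap2 _ _ _ (subspaceP F)).
  + by [].
  + by [].
  + by change (val F P (tconv g' (tconv g f)) = val F P (tconv g (tconv g' f)));
      rewrite tconvCA.
- exact: delta_lin.
- by move=> X [[c ->]|[g ->]]; right;
    [exists (top c); exact: ad_nu | exists (tder g); exact: ad_mu].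
- by move=> b; left; exists b.
- exact: nu_lin.
- move=> a b F; rewrite ad_nu; apply: functionals_eq => P f.
  exact: functional_balanced (subspaceP F) _ _ _ _.
- move=> a x y; apply: functionals_eq => P f; rewrite subspace_lin.
  exact: (tensor_linear P (subspaceP f)).
- move=> x y /(congr1 (fun F => val F [::] (tconst coefficient_id))).
  by [].
- move=> a b; rewrite ad_nu; apply: functionals_eq => P f.
  change (val f P (op a b) = conv (const_tensor (op a)) (val f) P b).
  by rewrite conv_const (scalar_comm _ (tensor_scalar P (subspaceP f)) (scalar_op a)).
Qed.

End Embedding.

Theorem theorem4 (K : fieldType) (B : lmodType K)
    (op : {bilinear B -> B -> B}) :
  in_DerPerm_succ op <->
  [/\ forall x1 x2 x3 : B, op x1 (op x2 x3) = op x2 (op x1 x3),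
      forall x1 x2 x3 x4 : B,
        associator op x1 (op x2 x3) x4 - associator op x1 x3 (op x2 x4) = 0
    & forall x1 x2 x3 x4 : B,
        op (associator op x1 x2 x3) x4 - op (associator op x1 x3 x2) x4 = 0].
Proof.
split=> [[A [mul [d [phi [mul_perm d_der phi_inj phi_op]]]]]|[comm shift sym]].
  have phi_assoc a b c :
      phi (associator op a b c) = mul (mul (d (d (phi a))) (phi b)) (phi c).
    by rewrite raddfB /= !phi_op der_succ_associator.
  split=> [a b c|a b c x|a b c x]; [|apply/eqP; rewrite subr_eq0; apply/eqP ..];
    apply: phi_inj.
  - by rewrite !phi_op der_succ_left_comm.
  - by rewrite !phi_assoc !phi_op der_succ_assoc_shift.
  - by rewrite !phi_op !phi_assoc der_succ_assoc_sym.
apply: in_DerPerm_succ_of_identities => [//|a b c x|a b c x];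
  apply/eqP; rewrite -subr_eq0; apply/eqP.
  exact: shift.
exact: sym.
Qed.
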